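(* There is an absolute constant $c>0$ such that the following holds for every graph $G$, label set $\chi$ with $d\ge2$, cost vector $C$ and $\epsilon>0$. Set $\eta=\frac{4(m+n)\log d}{\epsilon}$ and let $K\ge c\,m^{3/2}d^2(m+n)^3\|C\|_\infty^2\epsilon^{-2}\log d$. Let $\hat\lambda=\lambda^{(K)}$ be the output of the accelerated edge message passing procedure (Accel-EMP) after $K$ iterations, and $\hat\mu=\mathrm{Proj}(\mu^{\hat\lambda})$. Then $\hat\mu\in\mathbb{L}_2$ and $$\mathbb{E}\,\langle C,\hat\mu\rangle\le\min_{\mu\in\mathbb{L}_2}\langle C,\mu\rangle+\epsilon.$$
   Context: Let $G=(V,E)$ be a finite undirected graph with $n=|V|$, $m=|E|$, every vertex incident to at least one edge; $N_i=\{e\in E:i\in e\}$. $\chi$ is a finite label set with $d=|\chi|\ge2$. Costs $C_i\in\mathbb{R}^\chi$, $C_e\in\mathbb{R}^{\chi^2}$; $\|C\|_\infty$ is the largest absolute entry; for $e=\{i,j\}$ (with a fixed orientation), $x_e=(x_i,x_j)$ and $(x_e)_i=x_i$. $\langle C,\mu\rangle=\sum_i\sum_xC_i(x)\mu_i(x)+\sum_e\sum_{x_e}C_e(x_e)\mu_e(x_e)$. $\mathbb{L}_2=\{\mu\ge0:\mu_i\in\Sigma^d\ \forall i,\ \sum_{x_e:(x_e)_i=x}\mu_e(x_e)=\mu_i(x)\ \forall e,\,i\in e,\,x\}$, with $\Sigma^d$ the probability simplex on $\chi$. Dual variables $\lambda\in\mathbb{R}^{2md}$ indexed by $(e,i,x)$.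 $\mu^\lambda_i(x)\propto\exp(-\eta C_i(x)+\eta\sum_{e\in N_i}\lambda_{e,i}(x))$, $\mu^\lambda_e(x_e)\propto\exp(-\eta C_e(x_e)-\eta\sum_{i\in e}\lambda_{e,i}((x_e)_i))$, each normalized; $S^\lambda_{e,i}(x)=\sum_{x_e:(x_e)_i=x}\mu^\lambda_e(x_e)$; slack $\nu^\lambda_{e,i}=S^\lambda_{e,i}-\mu^\lambda_i$. Accel-EMP: $\lambda^{(0)}=v^{(0)}=0$, $\theta_{-1}=1$; for $k=0,\dots,K-1$: $\theta_k=\frac{-\theta_{k-1}^2+\sqrt{\theta_{k-1}^4+4\theta_{k-1}^2}}{2}$; $y^{(k)}=\theta_kv^{(k)}+(1-\theta_k)\lambda^{(k)}$; sample $(e_k,i_k)$ independently and uniformly from $\{(e,i):e\in E,i\in e\}$; $\lambda^{(k+1)}$ equals $y^{(k)}$ except that block $(e_k,i_k)$ is set to $y^{(k)}_{e_k,i_k}(x)+\frac{1}{2\eta}\log(S^{y^{(k)}}_{e_k,i_k}(x)/\mu^{y^{(k)}}_{i_k}(x))$; $v^{(k+1)}$ equals $v^{(k)}$ except $v^{(k+1)}_{e_k,i_k}=v^{(k)}_{e_k,i_k}+\frac{1}{4m\eta\theta_k}\nu^{y^{(k)}}_{e_k,i_k}$. Rounding map: for $F\in\mathbb{R}_{>0}^{\chi\times\chi}$ and $r,c\in\Sigma^d$, with $r(F),c(F)$ the row/column sums, let $F'=\mathrm{diag}(a)F$ with $a(x)=\min\{r(x)/r(F)(x),1\}$, $F''=F'\mathrm{diag}(b)$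 with $b(x)=\min\{c(x)/c(F')(x),1\}$, $\mathrm{err}_r=r-r(F'')$, $\mathrm{err}_c=c-c(F'')$, output $F''+\mathrm{err}_r\mathrm{err}_c^\top/\|\mathrm{err}_c\|_1$ (or $F''$ if $\mathrm{err}_c=0$). $\mathrm{Proj}(\mu^\lambda)$: $\hat\mu_i=\mu^\lambda_i$, and for $e=\{i,j\}$, $\hat\mu_e$ is the rounding of $\mu^\lambda_e$ (rows indexed by $x_i$, columns by $x_j$) with $r=\mu^\lambda_i$, $c=\mu^\lambda_j$. Expectation is over the random block choices. *)

(* Defs.v *)
From HB Require Import structures.
From mathcomp Require Import all_boot all_order all_algebra.
From mathcomp Require Import reals sequences exp.
Set Implicit Arguments. Unset Strict Implicit. Unset Printing Implicit Defensive.
Import Order.TTheory GRing.Theory Num.Theory.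
Local Open Scope ring_scope.

Section AccelEMP.
Context {R : realType} {V E X : finType}.

(* A graph: vertex set V, edge set E, each edge e = {i,j} given with a fixed
   orientation ends e = (i, j).  Block index (e, b) : E * bool stands for the
   pair (e, i) with i = endpt e b (b = false: first end, b = true: second). *)
Variable ends : E -> V * V.

Definition endpt (e : E) (b : bool) : V := if b then (ends e).2 else (ends e).1.

Definition simple_graph : Prop :=
  (forall e, (ends e).1 != (ends e).2) /\
  (forall e f, (ends e = ends f \/ ends e = ((ends f).2, (ends f).1)) -> e = f).

Definition no_isolated : Prop := forall v : V, exists e b, endpt e b = v.

Variables (CV : V -> X -> R) (CE : E -> X -> X -> R).

Definition Cnorm : R :=
  Num.max (\big[Num.max/0]_(v : V) \big[Num.max/0]_(x : X) `|CV v x|)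
          (\big[Num.max/0]_(e : E) \big[Num.max/0]_(p : X * X) `|CE e p.1 p.2|).

Definition pairing (muv : V -> X -> R) (mue : E -> X -> X -> R) : R :=
  \sum_(v : V) \sum_(x : X) CV v x * muv v x
  + \sum_(e : E) \sum_(p : X * X) CE e p.1 p.2 * mue e p.1 p.2.

Definition inL2 (muv : V -> X -> R) (mue : E -> X -> X -> R) : Prop :=
  [/\ (forall v x, 0 <= muv v x),
      (forall e x y, 0 <= mue e x y),
      (forall v, \sum_(x : X) muv v x = 1),
      (forall e x, \sum_(y : X) mue e x y = muv (ends e).1 x) &
      (forall e y, \sum_(x : X) mue e x y = muv (ends e).2 y)].

Variable eta : R.

Definition dual := E -> bool -> X -> R.

Definition wV (lam : dual) (v : V) (x : X) : R :=
  expR (- eta * CV v x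
        + eta * \sum_(eb : E * bool | endpt eb.1 eb.2 == v) lam eb.1 eb.2 x).
Definition muV (lam : dual) (v : V) (x : X) : R :=
  wV lam v x / \sum_(x' : X) wV lam v x'.

Definition wE (lam : dual) (e : E) (x y : X) : R :=
  expR (- eta * CE e x y - eta * (lam e false x + lam e true y)).
Definition muE (lam : dual) (e : E) (x y : X) : R :=
  wE lam e x y / \sum_(p : X * X) wE lam e p.1 p.2.

Definition Smarg (lam : dual) (e : E) (b : bool) (x : X) : R :=
  if b then \sum_(y : X) muE lam e y x else \sum_(y : X) muE lam e x y.

Definition slack (lam : dual) (e : E) (b : bool) (x : X) : R :=
  Smarg lam e b x - muV lam (endpt e b) x.

(* theta_prev k = theta_{k-1};  theta_{-1} = 1 *)
Definition theta_step (t : R) : R :=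
  (- t ^+ 2 + Num.sqrt (t ^+ 4 + 4 * t ^+ 2)) / 2.
Fixpoint theta_prev (k : nat) : R :=
  match k with 0%N => 1 | k'.+1 => theta_step (theta_prev k') end.
Definition theta (k : nat) : R := theta_prev k.+1.

Definition emp_step (k : nat) (blk : E * bool) (st : dual * dual) : dual * dual :=
  let lam := st.1 in let w := st.2 in
  let th := theta k in
  let y : dual := fun e b x => th * w e b x + (1 - th) * lam e b x in
  let m : R := #|E|%:R in
  ((fun e b x => if (e, b) == blk then
        y e b x + 1 / (2 * eta) * ln (Smarg y e b x / muV y (endpt e b) x)
      else y e b x),
   (fun e b x => if (e, b) == blk then
        w e b x + 1 / (4 * m * eta * th) * slack y e b x
      else w e b x)).

Fixpoint emp_run (k : nat) (s : seq (E * bool)) (st : dual * dual) : dual * dual :=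
  match s with
  | [::] => st
  | blk :: s' => emp_run k.+1 s' (emp_step k blk st)
  end.

Definition accel_emp (K : nat) (s : K.-tuple (E * bool)) : dual :=
  (emp_run 0 s ((fun _ _ _ => 0), (fun _ _ _ => 0))).1.

End AccelEMP.

Section Rounding.
Context {R : realType} {X : finType}.

(* rounding map onto the transportation polytope with marginals r, c *)
Definition round_mx (F : X -> X -> R) (r c : X -> R) : X -> X -> R :=
  let a x := Num.min (r x / \sum_(y : X) F x y) 1 in
  let F1 x y := a x * F x y in
  let b y := Num.min (c y / \sum_(x : X) F1 x y) 1 in
  let F2 x y := F1 x y * b y in
  let er x := r x - \sum_(y : X) F2 x y in
  let ec y := c y - \sum_(x : X) F2 x y in
  if [forall y, ec y == 0] then F2
  else fun x y => F2 x y + er x * ec y / \sum_(z : X) `|ec z|.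

End Rounding.

Definition projV {R : realType} {V E X : finType} (ends : E -> V * V)
  (CV : V -> X -> R) (eta : R) (lam : @dual R E X) : V -> X -> R :=
  muV ends CV eta lam.
Definition projE {R : realType} {V E X : finType} (ends : E -> V * V)
  (CV : V -> X -> R) (CE : E -> X -> X -> R) (eta : R) (lam : @dual R E X)
  : E -> X -> X -> R :=
  fun e => round_mx (muE CE eta lam e)
                    (muV ends CV eta lam (ends e).1) (muV ends CV eta lam (ends e).2).

(* Main.v *)
(* Up to the factor eta, the dual objective is a sum of log-partition functions,
   and everything is read off Gibbs' variational principle: for every family mu
   of distributions with slacks nu, the objective at lambda is at least
   H(mu) - eta (<C, mu> + <lambda, nu>), with equality at mu^lambda.

   - A block step decreases the objective by twice the logarithm of a Hellinger
     affinity, hence by |nu_b|_1^2 / 4. This is the descent inequality of a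
     function with block smoothness 2 eta, so accelerated randomised coordinate
     descent reduces the expected gap at rate O(1 / K^2), with a constant
     quadratic in the norm of the comparator.
   - Slater's argument bounds the norm of a block-centred comparator that is no
     worse than 0.
   - The gap at the output bounds each slack. Perturbing a feasible point by
     O(d max |nu|) makes it feasible for the polytope with the slacks of
     mu^lambda, where mu^lambda minimises the entropic objective; the rounding
     moves mu^lambda by O(|nu|_1). *)
Require Import Defs.
From HB Require Import structures.
From mathcomp Require Import all_boot all_order all_algebra.
From mathcomp Require Import reals sequences exp.
From mathcomp Require Import ring lra.
Set Implicit Arguments.
Unset Strict Implicit.
Unset Printing Implicit Defensive.
Import Order.TTheory GRing.Theory Num.Theory.
Local Open Scope ring_scope.

(** * Finite distributions and Gibbs' variational principle *)

Section FiniteDistributions.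
Context {R : realType} {T : finType}.
Implicit Types (a q : T -> R).

Definition pmf q : Prop := (forall x, 0 <= q x) /\ \sum_x q x = 1.

Definition entropy q : R := - \sum_x q x * ln (q x).

Definition lse a : R := ln (\sum_x expR (a x)).

Definition softmax a (x : T) : R := expR (a x) / \sum_y expR (a y).

Lemma pmf_le1 q : pmf q -> forall x, q x <= 1.
Proof.
by move=> [q0 q1] x; rewrite -q1 (bigD1 x) //= lerDl sumr_ge0.
Qed.

Lemma pmf_uniform : (0 < #|T|)%N -> pmf (fun=> #|T|%:R^-1).
Proof.
move=> T0; split=> [x|]; first by rewrite invr_ge0 ler0n.
by rewrite sumr_const -[LHS]mulr_natl mulfV // pnatr_eq0 -lt0n.
Qed.

Lemma pmf_point (t : T) : pmf (fun x => (x == t)%:R).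
Proof.
split=> [x|]; first exact: ler0n.
by rewrite (bigD1 t) //= eqxx big1 ?addr0 // => x /negPf->.
Qed.

Lemma sumr_gt0 a : (0 < #|T|)%N -> (forall x, 0 < a x) -> 0 < \sum_x a x.
Proof.
move=> /card_gt0P[t _] a0; rewrite (bigD1 t) //= ltr_pwDl //.
by apply: sumr_ge0 => x _; exact: ltW.
Qed.

Lemma sum_expR_gt0 a : (0 < #|T|)%N -> 0 < \sum_x expR (a x).
Proof. by move=> T0; apply: sumr_gt0 => // x; exact: expR_gt0. Qed.

Lemma softmax_gt0 a : (0 < #|T|)%N -> forall x, 0 < softmax a x.
Proof. by move=> T0 x; rewrite divr_gt0 ?expR_gt0 ?sum_expR_gt0. Qed.

Lemma pmf_softmax a : (0 < #|T|)%N -> pmf (softmax a).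
Proof.
move=> T0; split=> [x|]; first exact/ltW/softmax_gt0.
by rewrite -mulr_suml mulfV // gt_eqF ?sum_expR_gt0.
Qed.

Lemma pmf_card_gt0 q : pmf q -> (0 < #|T|)%N.
Proof.
case=> _ q1; rewrite lt0n; apply/eqP => T0.
suff : \sum_x q x = 0 by rewrite q1 => /eqP; rewrite oner_eq0.
by apply: big1 => x; have := card0_eq T0 x.
Qed.

(** Nonnegativity of the relative entropy of [q] with respect to [softmax a], obtained termwise from
    [ln u <= u - 1]. *)
Lemma gibbs_variational a q : pmf q ->
  \sum_x q x * a x + entropy q <= lse a.
Proof.
move=> pq; have [q0 q1] := pq; have T0 := pmf_card_gt0 pq.
have Z0 := sum_expR_gt0 a T0; set Z := \sum_x expR (a x) in Z0.
have term x : q x * (a x - ln (q x) - ln Z) <= expR (a x) / Z - q x.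
  have [qx0|qx0] := eqVneq (q x) 0.
    by rewrite qx0 mul0r subr0 divr_ge0 ?expR_ge0 ?ltW.
  have qp : 0 < q x by rewrite lt_def qx0 q0.
  have -> : a x - ln (q x) - ln Z = ln (expR (a x) / (q x * Z)).
    by rewrite ln_div ?posrE ?mulr_gt0 ?expR_gt0 // expRK lnM ?posrE // opprD addrA.
  have -> : expR (a x) / Z - q x = q x * (expR (a x) / (q x * Z) - 1).
    by field; rewrite qx0 gt_eqF.
  rewrite ler_pM2l //.
  set u := _ / _; have u0 : 0 < u by rewrite divr_gt0 ?mulr_gt0 ?expR_gt0.
  have := @le_ln1Dx R (u - 1); rewrite addrCA subrr addr0; apply; lra.
have := ler_sum (index_enum T) (P := xpredT) (fun x _ => term x).
rewrite sumrB q1 -mulr_suml mulfV ?gt_eqF // subrr.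
under eq_bigr do rewrite -addrA mulrDr mulrDr mulrN mulrN.
rewrite !big_split /= !sumrN -mulr_suml q1 mul1r addrA subr_le0.
exact.
Qed.

(** The equality case: [a x - ln (softmax a x)] is the constant [lse a]. *)
Lemma gibbs_softmax a : (0 < #|T|)%N ->
  \sum_x softmax a x * a x + entropy (softmax a) = lse a.
Proof.
move=> T0; have Z0 := sum_expR_gt0 a T0.
rewrite /entropy -sumrB.
under eq_bigr => x _ do
  rewrite {3}/softmax ln_div ?posrE ?expR_gt0 // expRK -mulrBr opprB addrCA subrr addr0.
by rewrite -mulr_suml (pmf_softmax a T0).2 mul1r.
Qed.

Lemma entropy_ge0 q : pmf q -> 0 <= entropy q.
Proof.
move=> pq; rewrite oppr_ge0; apply: sumr_le0 => x _.
by rewrite mulr_ge0_le0 ?pq.1 // ln_le0 ?pmf_le1.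
Qed.

Lemma entropy_le q : pmf q -> entropy q <= ln #|T|%:R.
Proof.
move=> pq; have := gibbs_variational (fun=> 0) pq.
rewrite /lse big1 ?add0r => [|x _]; last by rewrite mulr0.
by under eq_bigr do rewrite expR0; rewrite sumr_const.
Qed.

End FiniteDistributions.

(** * Hellinger affinity against the l1 distance *)

Section Hellinger.
Context {R : realType} {T : finType}.

(* A = sum mu g is the Hellinger affinity of mu and mu g^2; conclude from
   2 ln A <= 2 (A - 1) and Cauchy-Schwarz, since
   2 (1 - A) = sum mu (g - 1)^2, while |g^2 - 1| = |g - 1| (g + 1). *)
Lemma ln_affinity_le (mu g : T -> R) : pmf mu -> (forall x, 0 < g x) ->
    (forall x, 0 < mu x) -> \sum_x mu x * g x ^+ 2 = 1 ->
  2 * ln (\sum_x mu x * g x) <= - (\sum_x `|mu x * g x ^+ 2 - mu x|) ^+ 2 / 4.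
Proof.
move=> pm g0 m0 g2; have m1 := pm.2; set A := \sum_x mu x * g x.
have A0 : 0 < A.
  by apply: sumr_gt0 => [|x]; [exact: pmf_card_gt0 pm | exact: mulr_gt0].
set N := \sum_x _.
have lnA : ln A <= A - 1.
  by have := @le_ln1Dx R (A - 1); rewrite addrCA subrr addr0; apply; lra.
have NE : N = \sum_x mu x * (`|g x - 1| * (g x + 1)).
  apply: eq_bigr => x _.
  have -> : mu x * g x ^+ 2 - mu x = mu x * ((g x - 1) * (g x + 1)) by ring.
  by rewrite !normrM (gtr0_norm (m0 x)) (@gtr0_norm _ (g x + 1)) //; have := g0 x; lra.
(* Cauchy-Schwarz as a nonnegative square. The optimal multiplier is [N] over the sum of
   [mu (g + 1)^2]; that sum is [2 + 2 * A], replaced here by its bound 4. *)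
have sq : 0 <= \sum_x mu x * (`|g x - 1| - N / 4 * (g x + 1)) ^+ 2.
  by apply: sumr_ge0 => x _; rewrite mulr_ge0 ?sqr_ge0 ?ltW.
have E c : \sum_x mu x * (`|g x - 1| - c * (g x + 1)) ^+ 2 =
    (1 + c ^+ 2) * 2 + 2 * (c ^+ 2 - 1) * A - 2 * c * N.
  transitivity (\sum_x ((1 + c ^+ 2) * (mu x * g x ^+ 2) + (1 + c ^+ 2) * mu x
      + 2 * (c ^+ 2 - 1) * (mu x * g x)
      + - (2 * c) * (mu x * (`|g x - 1| * (g x + 1))))).
    apply: eq_bigr => x _; have h := real_normK (num_real (g x - 1)).
    rewrite sqrrB exprMn h; ring.
  rewrite !big_split /= -!mulr_sumr g2 m1 -NE -/A; ring.
have A1 : A <= 1.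
  have : 0 <= \sum_x mu x * (g x - 1) ^+ 2.
    by apply: sumr_ge0 => x _; rewrite mulr_ge0 ?sqr_ge0 ?ltW.
  have -> : \sum_x mu x * (g x - 1) ^+ 2 = 1 + 1 - 2 * A.
      transitivity (\sum_x (mu x * g x ^+ 2 + mu x + - 2 * (mu x * g x))).
        by apply: eq_bigr => x _; ring.
      by rewrite !big_split /= -mulr_sumr g2 m1 -/A; ring.
  lra.
rewrite E in sq; have N2 := sqr_ge0 N; nra.
Qed.
End Hellinger.

(** * Rounding *)

Section RoundingLemmas.
Context {R : realType} {X : finType}.
Variables (F : X -> X -> R) (r c : X -> R).
Hypothesis F_ge0 : forall x y, 0 <= F x y.
Hypothesis F_sum1 : \sum_x \sum_y F x y = 1.
Hypotheses (r_pmf : pmf r) (c_pmf : pmf c).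

Let row_scale x := Num.min (r x / \sum_y F x y) 1.
Let F1 x y := row_scale x * F x y.
Let col_scale y := Num.min (c y / \sum_x F1 x y) 1.
Let F2 x y := F1 x y * col_scale y.
Let er x := r x - \sum_y F2 x y.
Let ec y := c y - \sum_x F2 x y.

(* At [s = 0] the quotient is [0], which is harmless since it multiplies [s]. *)
Let scale_le (t s : R) : 0 <= t -> 0 <= s ->
  [/\ 0 <= Num.min (t / s) 1, Num.min (t / s) 1 <= 1, Num.min (t / s) 1 * s <= t
    & s - Num.min (t / s) 1 * s <= `|t - s|].
Proof.
move=> t0 s0; have [->|sn0] := eqVneq s 0.
  by rewrite invr0 !mulr0 subr0 minEle ler01.
have sp : 0 < s by rewrite lt_def sn0.
rewrite minEle ler_pdivrMr // mul1r; case: (leP t s) => h; rewrite ?mul1r.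
  rewrite divfK // divr_ge0 //; split=> //; first by rewrite ler_pdivrMr ?mul1r.
  by rewrite distrC ler_norm.
by split=> //; [exact: ltW | rewrite subrr].
Qed.

Let rF_ge0 x : 0 <= \sum_y F x y. Proof. exact: sumr_ge0. Qed.
Let F1_ge0 x y : 0 <= F1 x y.
Proof. by rewrite mulr_ge0 //; case: (scale_le (r_pmf.1 x) (rF_ge0 x)). Qed.
Let F1_le x y : F1 x y <= F x y.
Proof.
by rewrite -[leRHS]mul1r ler_wpM2r //; case: (scale_le (r_pmf.1 x) (rF_ge0 x)).
Qed.
Let cF1_ge0 y : 0 <= \sum_x F1 x y. Proof. exact: sumr_ge0. Qed.
Let F2_ge0 x y : 0 <= F2 x y.
Proof. by rewrite mulr_ge0 //; case: (scale_le (c_pmf.1 y) (cF1_ge0 y)). Qed.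
Let F2_le x y : F2 x y <= F1 x y.
Proof.
by rewrite -[leRHS]mulr1 ler_wpM2l //; case: (scale_le (c_pmf.1 y) (cF1_ge0 y)).
Qed.

Let er_ge0 x : 0 <= er x.
Proof.
rewrite subr_ge0; apply: (@le_trans _ _ (\sum_y F1 x y)); first exact: ler_sum.
by rewrite -mulr_sumr; case: (scale_le (r_pmf.1 x) (rF_ge0 x)).
Qed.
Let ec_ge0 y : 0 <= ec y.
Proof.
by rewrite subr_ge0 -mulr_suml mulrC; case: (scale_le (c_pmf.1 y) (cF1_ge0 y)).
Qed.

Let defect := 1 - \sum_x \sum_y F2 x y.
Let er_sum : \sum_x er x = defect. Proof. by rewrite sumrB r_pmf.2. Qed.
Let ec_sum : \sum_y ec y = defect.
Proof. by rewrite sumrB c_pmf.2 exchange_big. Qed.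

(** Row scaling loses at most the row error. Column scaling loses only the excess of a column of
    [F1] over [c]; since [F1 <= F], this is at most the column error of [F]. *)
Let defect_le : defect <=
  \sum_x `|r x - \sum_y F x y| + \sum_y `|c y - \sum_x F x y|.
Proof.
rewrite /defect -F_sum1.
apply: (@le_trans _ _ ((\sum_x \sum_y F x y - \sum_x \sum_y F1 x y)
   + (\sum_x \sum_y F1 x y - \sum_x \sum_y F2 x y))); first by rewrite addrA subrK.
apply: lerD.
  rewrite -sumrB; apply: ler_sum => x _; rewrite -mulr_sumr.
  by case: (scale_le (r_pmf.1 x) (rF_ge0 x)).
rewrite exchange_big [X in _ - X <= _]exchange_big -sumrB; apply: ler_sum => y _.
rewrite -mulr_suml [X in _ - X]mulrC.
have [le1|lt1] := leP (\sum_x F1 x y) (c y).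
  rewrite /col_scale minEle; case: ifP => [|_]; last by rewrite mul1r subrr.
  have [->|s0] := eqVneq (\sum_x F1 x y) 0; first by rewrite mulr0 subrr.
  rewrite divfK // => _; apply: (@le_trans _ _ 0) => //; lra.
have h : \sum_x F1 x y <= \sum_x F x y by apply: ler_sum.
case: (scale_le (c_pmf.1 y) (cF1_ge0 y)) => _ _ _ /le_trans; apply.
by rewrite ltr0_norm ?subr_lt0 // ltr0_norm ?subr_lt0 ?(lt_le_trans lt1) // lerN2 lerB.
Qed.

(** Scaling only removes mass, so [er] and [ec] are nonnegative with common sum [defect], and the
    rank-one term restores both marginals. The factor 2 counts [defect] once as mass removed and
    once as mass added back. *)
Lemma round_mx_spec :
  [/\ forall x y, 0 <= round_mx F r c x y,
      forall x, \sum_y round_mx F r c x y = r x,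
      forall y, \sum_x round_mx F r c x y = c y
    & \sum_x \sum_y `|round_mx F r c x y - F x y| <=
      2 * (\sum_x `|r x - \sum_y F x y| + \sum_y `|c y - \sum_x F x y|)].
Proof.
have F2F x y : `|F2 x y - F x y| = F x y - F2 x y.
  by rewrite distrC ger0_norm // subr_ge0 (le_trans (F2_le _ _)).
have F2F_sum : \sum_x \sum_y (F x y - F2 x y) = defect.
  by under eq_bigr do rewrite sumrB; rewrite sumrB F_sum1.
have d0 : 0 <= defect by rewrite -er_sum sumr_ge0.
have dle := defect_le.
rewrite /round_mx -/row_scale -/F1 -/col_scale -/F2 -/er -/ec.
case: ifPn => [/forallP ec0|ecN0].
  have D0 : defect = 0 by rewrite -ec_sum big1 // => y _; exact/eqP/ec0.
  have er0 x : er x = 0.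
    move: er_sum; rewrite D0 => /eqP; rewrite psumr_eq0 // => /allP/(_ x).
    by rewrite mem_index_enum => /(_ isT)/eqP.
  split=> // [x|y|].
  - by apply/esym/eqP; rewrite -subr_eq0; exact/eqP/er0.
  - by apply/esym/eqP; rewrite -subr_eq0; exact: ec0.
  under eq_bigr do under eq_bigr do rewrite F2F.
  rewrite F2F_sum; lra.
have ecs : \sum_z `|ec z| = defect.
  by rewrite -ec_sum; apply: eq_bigr => y _; rewrite ger0_norm.
rewrite ecs.
have D0 : defect != 0.
  apply: contraNneq ecN0 => D0; apply/forallP => y.
  move: ec_sum; rewrite D0 => /eqP; rewrite psumr_eq0 // => /allP/(_ y).
  by rewrite mem_index_enum => /(_ isT).
have Dp : 0 < defect by rewrite lt_def D0.
have outer_ge0 x y : 0 <= er x * ec y / defect by rewrite divr_ge0 ?(ltW Dp) ?mulr_ge0.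
have outer_row x : \sum_y er x * ec y / defect = er x.
  by rewrite -mulr_suml -mulr_sumr ec_sum mulfK.
have outer_col y : \sum_x er x * ec y / defect = ec y.
  by rewrite -mulr_suml -mulr_suml er_sum mulrAC divff // mul1r.
split=> [x y|x|y|].
- exact: (addr_ge0 (F2_ge0 x y) (outer_ge0 x y)).
- by rewrite big_split /= outer_row addrC subrK.
- by rewrite big_split /= outer_col addrC subrK.
apply: (@le_trans _ _ (\sum_x \sum_y (F x y - F2 x y)
   + \sum_x \sum_y er x * ec y / defect)); last first.
  rewrite F2F_sum; under [X in _ + X]eq_bigr do rewrite outer_row.
  rewrite er_sum; lra.
rewrite -big_split; apply: ler_sum => x _; rewrite -big_split; apply: ler_sum => y _ /=.
by rewrite addrAC -F2F (le_trans (ler_normD _ _)) // lerD2l (ger0_norm (outer_ge0 x y)).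
Qed.

End RoundingLemmas.

(** * The dual objective *)

Lemma sum_pairE {R : nmodType} {I J : finType} (F : I -> J -> R) :
  \sum_(p : I * J) F p.1 p.2 = \sum_i \sum_j F i j.
Proof. by rewrite pair_bigA. Qed.

Section DualFunction.
Context {R : realType} {V E X : finType}.
Variables (ends : E -> V * V) (CV : V -> X -> R) (CE : E -> X -> X -> R) (eta : R).
Hypothesis X_gt0 : (0 < #|X|)%N.
Implicit Types (lam z nu : @dual R E X) (muv : V -> X -> R) (mue : E -> X -> X -> R).

Definition vertex_logits lam (v : V) (x : X) : R :=
  - eta * CV v x + eta * \sum_(eb | endpt ends eb.1 eb.2 == v) lam eb.1 eb.2 x.

Definition edge_logits lam (e : E) (p : X * X) : R :=
  - eta * CE e p.1 p.2 - eta * (lam e false p.1 + lam e true p.2).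

(** This function is to be minimised: it is convex, and its gradient in block [(e, b)] is [- eta]
    times the slack of that block. *)
Definition dual_obj lam : R :=
  \sum_v lse (vertex_logits lam v) + \sum_e lse (edge_logits lam e).

Definition marg (F : X -> X -> R) (b : bool) (x : X) : R :=
  if b then \sum_y F y x else \sum_y F x y.

Definition residual muv mue (e : E) (b : bool) (x : X) : R :=
  marg (mue e) b x - muv (endpt ends e b) x.

Definition inner lam nu : R :=
  \sum_(eb : E * bool) \sum_x lam eb.1 eb.2 x * nu eb.1 eb.2 x.

(** The update of [lam] in [emp_step], isolated so that it can also be tried from the final
    output. *)
Definition block_step lam (e : E) (b : bool) : @dual R E X :=
  fun e' b' x => if (e', b') == (e, b) then
    lam e' b' x + 1 / (2 * eta) *
      ln (Smarg CE eta lam e' b' x / muV ends CV eta lam (endpt ends e' b') x)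
  else lam e' b' x.

Definition pmfs muv mue : Prop :=
  (forall v, pmf (muv v)) /\ (forall e, pmf (fun p => mue e p.1 p.2)).

Definition total_entropy muv mue : R :=
  \sum_v entropy (muv v) + \sum_e entropy (fun p => mue e p.1 p.2).

Lemma sum_blocks (F : E -> bool -> R) :
  \sum_(eb : E * bool) F eb.1 eb.2 = \sum_e (F e false + F e true).
Proof. by rewrite sum_pairE; apply: eq_bigr => e _; rewrite big_bool addrC. Qed.

Lemma innerDl lam z nu :
  inner (fun e b x => lam e b x + z e b x) nu = inner lam nu + inner z nu.
Proof.
rewrite -big_split; apply: eq_bigr => eb _; rewrite -big_split /=.
by apply: eq_bigr => x _; rewrite mulrDl.
Qed.

Lemma innerZl (k : R) lam nu :
  inner (fun e b x => k * lam e b x) nu = k * inner lam nu.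
Proof.
rewrite mulr_sumr; apply: eq_bigr => eb _; rewrite mulr_sumr.
by apply: eq_bigr => x _; rewrite mulrA.
Qed.

Lemma innerBl lam z nu :
  inner (fun e b x => lam e b x - z e b x) nu = inner lam nu - inner z nu.
Proof.
rewrite -sumrB; apply: eq_bigr => eb _; rewrite -sumrB /=.
by apply: eq_bigr => x _; rewrite mulrBl.
Qed.

(** Each block enters the logits of its vertex with sign plus and those of its edge with sign minus.
    Regrouping the vertex sums by blocks therefore pairs [lam] with the residual. *)
Lemma lagrangian lam muv mue :
  \sum_v \sum_x muv v x * vertex_logits lam v x
  + \sum_e \sum_p mue e p.1 p.2 * edge_logits lam e p
  = - eta * (pairing CV CE muv mue + inner lam (residual muv mue)).
Proof.
have vertexE : \sum_v \sum_x muv v x * vertex_logits lam v x =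
    - eta * \sum_v \sum_x CV v x * muv v x
    + eta * \sum_(eb : E * bool) \sum_x
        lam eb.1 eb.2 x * muv (endpt ends eb.1 eb.2) x.
  rewrite (partition_big (fun eb => endpt ends eb.1 eb.2) xpredT) //=.
  rewrite !mulr_sumr -big_split; apply: eq_bigr => v _ /=.
  rewrite exchange_big /= !mulr_sumr -big_split; apply: eq_bigr => x _ /=.
  rewrite /vertex_logits mulrDr; congr (_ + _); first by ring.
  rewrite mulrCA; congr (_ * _); rewrite mulr_sumr.
  by apply: eq_bigr => eb /eqP ->; rewrite mulrC.
have edgeE : \sum_e \sum_p mue e p.1 p.2 * edge_logits lam e p =
    - eta * \sum_e \sum_p CE e p.1 p.2 * mue e p.1 p.2
    - eta * \sum_(eb : E * bool) \sum_x lam eb.1 eb.2 x * marg (mue eb.1) eb.2 x.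
  rewrite (sum_blocks (fun e b => \sum_x lam e b x * marg (mue e) b x)).
  rewrite !mulr_sumr -sumrB; apply: eq_bigr => e _ /=.
  have -> : \sum_x lam e false x * (\sum_y mue e x y) =
      \sum_p lam e false p.1 * mue e p.1 p.2.
    rewrite (sum_pairE (fun x y => lam e false x * mue e x y)).
    by apply: eq_bigr => x _; rewrite mulr_sumr.
  have -> : \sum_x lam e true x * (\sum_y mue e y x) =
      \sum_p lam e true p.2 * mue e p.1 p.2.
    rewrite (sum_pairE (fun x y => lam e true y * mue e x y)) exchange_big.
    by apply: eq_bigr => x _; rewrite mulr_sumr.
  rewrite -big_split !mulr_sumr -sumrB; apply: eq_bigr => p _ /=.
  rewrite /edge_logits; ring.
have -> : inner lam (residual muv mue) =
    \sum_(eb : E * bool) \sum_x lam eb.1 eb.2 x * marg (mue eb.1) eb.2 x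
    - \sum_(eb : E * bool) \sum_x lam eb.1 eb.2 x * muv (endpt ends eb.1 eb.2) x.
  rewrite -sumrB; apply: eq_bigr => eb _; rewrite -sumrB; apply: eq_bigr => x _.
  by rewrite mulrBr.
rewrite vertexE edgeE /pairing; ring.
Qed.

Lemma dual_obj_ge lam muv mue : pmfs muv mue ->
  - eta * (pairing CV CE muv mue + inner lam (residual muv mue))
  + total_entropy muv mue <= dual_obj lam.
Proof.
move=> [pv pe]; rewrite -lagrangian addrACA -!big_split /=.
by apply: lerD; apply: ler_sum => ? _; exact: gibbs_variational.
Qed.

Let XX_gt0 : (0 < #|{: X * X}|)%N. Proof. by rewrite card_prod muln_gt0 X_gt0. Qed.

Lemma dual_obj_eq lam :
  dual_obj lam = - eta * (pairing CV CE (muV ends CV eta lam) (muE CE eta lam)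
                          + inner lam (slack ends CV CE eta lam))
                 + total_entropy (muV ends CV eta lam) (muE CE eta lam).
Proof.
rewrite -lagrangian addrACA -!big_split /=; congr (_ + _).
  by apply: eq_bigr => v _; rewrite -gibbs_softmax.
by apply: eq_bigr => e _; rewrite -gibbs_softmax.
Qed.

Lemma pmfs_mu lam : pmfs (muV ends CV eta lam) (muE CE eta lam).
Proof.
split=> [v|e]; first exact: (pmf_softmax (vertex_logits lam v) X_gt0).
exact: (pmf_softmax (edge_logits lam e) XX_gt0).
Qed.

Lemma muV_gt0 lam v x : 0 < muV ends CV eta lam v x.
Proof. exact: (softmax_gt0 (vertex_logits lam v) X_gt0 x). Qed.

Lemma muE_gt0 lam e x y : 0 < muE CE eta lam e x y.
Proof. exact: (softmax_gt0 (edge_logits lam e) XX_gt0 (x, y)). Qed.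

Lemma marg_pmf (F : X -> X -> R) (b : bool) :
  pmf (fun p => F p.1 p.2) -> pmf (marg F b).
Proof.
move=> [F0 F1]; rewrite sum_pairE in F1.
have {}F0 x y : 0 <= F x y by exact: (F0 (x, y)).
by case: b; split=> [x|] /=; rewrite ?sumr_ge0 //; rewrite exchange_big.
Qed.

Lemma Smarg_gt0 lam e b x : 0 < Smarg CE eta lam e b x.
Proof.
by rewrite /Smarg; case: b; apply: sumr_gt0 => // y; exact: muE_gt0.
Qed.

Lemma Smarg_pmf lam e b : pmf (Smarg CE eta lam e b).
Proof. exact: (marg_pmf b ((pmfs_mu lam).2 e)). Qed.

Lemma slack_sum0 lam e b : \sum_x slack ends CV CE eta lam e b x = 0.
Proof. by rewrite sumrB (Smarg_pmf lam e b).2 ((pmfs_mu lam).1 _).2 subrr. Qed.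

Lemma total_entropy_ge0 muv mue : pmfs muv mue -> 0 <= total_entropy muv mue.
Proof. by move=> [pv pe]; rewrite addr_ge0 // sumr_ge0 // => ? _; exact: entropy_ge0. Qed.

Lemma total_entropy_le muv mue : pmfs muv mue ->
  total_entropy muv mue <= (#|V|%:R + 2 * #|E|%:R) * ln #|X|%:R.
Proof.
move=> [pv pe]; rewrite mulrDl; apply: lerD.
  apply: (@le_trans _ _ (\sum_(v : V) ln #|X|%:R)).
    by apply: ler_sum => v _; exact: entropy_le.
  by rewrite sumr_const mulr_natl.
apply: (@le_trans _ _ (\sum_(e : E) (ln #|X|%:R + ln #|X|%:R))).
  apply: ler_sum => e _; apply: le_trans (entropy_le (pe e)) _.
  by rewrite card_prod natrM lnM // posrE ltr0n.
rewrite sumr_const -[leLHS]mulr_natl; lra.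
Qed.

(** Convexity without derivatives: the variational bound given by mu^lam is affine in the dual point
    and tight at [lam], hence a supporting hyperplane there. *)
Lemma dual_obj_grad lam z :
  dual_obj lam - eta * inner (fun e b x => z e b x - lam e b x)
                             (slack ends CV CE eta lam) <= dual_obj z.
Proof.
have := dual_obj_ge z (pmfs_mu lam).
rewrite (dual_obj_eq lam) innerBl.
have -> : inner z (residual (muV ends CV eta lam) (muE CE eta lam)) =
  inner z (slack ends CV CE eta lam) by [].
lra.
Qed.

(** Slacks sum to zero on each block, so blockwise constants are orthogonal to the gradient. This
    allows a comparator to be centred at no cost. *)
Lemma dual_obj_shift lam (k : E -> bool -> R) :
  dual_obj (fun e b x => lam e b x - k e b) <= dual_obj lam.
Proof.
set z : dual := fun e b x => lam e b x - k e b.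
have := dual_obj_grad z lam.
suff -> : inner (fun e b x => lam e b x - z e b x) (slack ends CV CE eta z) = 0.
  by rewrite mulr0 subr0.
apply: big1 => eb _; under eq_bigr do rewrite /z subKr.
by rewrite -mulr_sumr slack_sum0 mulr0.
Qed.

(* The step equalises the two marginals of the block half-way, so the dual
   objective changes by twice the log of their Hellinger affinity. *)
Lemma dual_obj_block_step lam (e : E) (b : bool) : eta != 0 ->
  dual_obj (block_step lam e b)
  <= dual_obj lam - (\sum_x `|slack ends CV CE eta lam e b x|) ^+ 2 / 4.
Proof.
move=> eta0; set lam' := block_step lam e b.
set S := Smarg CE eta lam e b; set mu := muV ends CV eta lam (endpt ends e b).
(* The factor by which the step multiplies the vertex weights: [eta] times the increment of the
   block is half the log-ratio, so [mu * g ^+ 2 = S]. *)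
pose g x := expR (ln (S x / mu x) / 2).
have mu0 x : 0 < mu x by exact: muV_gt0.
have S0 x : 0 < S x by exact: Smarg_gt0.
have g0 x : 0 < g x by exact: expR_gt0.
have g2 x : g x ^+ 2 = S x / mu x.
  by rewrite expr2 -expRD -splitr lnK // posrE divr_gt0.
have mug2 x : mu x * g x ^+ 2 = S x by rewrite g2 mulrC divfK // gt_eqF.
have lam'E x : lam' e b x = lam e b x + (ln (S x / mu x) / 2) / eta.
  by rewrite /lam' /block_step eqxx -/(S x) -/(mu x); congr (_ + _); field.
have lam'N e' b' x : (e', b') != (e, b) -> lam' e' b' x = lam e' b' x.
  by move=> /negPf h; rewrite /lam' /block_step h.
have muP : pmf mu by exact: ((pmfs_mu lam).1 _).
have SP : pmf S by exact: Smarg_pmf.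
set A := \sum_x mu x * g x.
have A0 : 0 < A by apply: sumr_gt0 => // x; exact: (mulr_gt0 (mu0 x) (g0 x)).
have lnMA u : 0 < u -> ln u + ln A = ln (u * A) by move=> u0; rewrite lnM.
have vertex v : lse (vertex_logits lam' v) =
    lse (vertex_logits lam v) + (if v == endpt ends e b then ln A else 0).
  case: eqVneq => [->|vN]; last first.
    rewrite addr0; congr ln; apply: eq_bigr => x _; congr (expR (_ + _ * _)).
    apply: eq_bigr => -[e' b'] /= /eqP ev; rewrite lam'N //.
    by apply: contra_neq vN => -[<- <-].
  rewrite /lse; have Z0 := sum_expR_gt0 (vertex_logits lam (endpt ends e b)) X_gt0.
  rewrite lnMA //; congr ln.
  rewrite /A mulr_sumr; apply: eq_bigr => x _.
  have -> : vertex_logits lam' (endpt ends e b) x =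
      vertex_logits lam (endpt ends e b) x + ln (S x / mu x) / 2.
    rewrite /vertex_logits -addrA; congr (_ + _).
    rewrite (bigD1 (e, b)) //= [in RHS](bigD1 (e, b)) //= lam'E.
    rewrite (eq_bigr (fun i => lam i.1 i.2 x)) => [|[e' b'] /= /andP[_ /lam'N] //].
    by field.
  by rewrite expRD -/(g x) /mu /muV /wV mulrA mulrCA mulfV ?mulr1 // gt_eqF.
have edge e' : lse (edge_logits lam' e') =
    lse (edge_logits lam e') + (if e' == e then ln A else 0).
  case: eqVneq => [->|eN]; last first.
    rewrite addr0; congr ln; apply: eq_bigr => p _; congr expR.
    by rewrite /edge_logits !lam'N // xpair_eqE (negPf eN).
  rewrite /lse; have Z0 := sum_expR_gt0 (edge_logits lam e) XX_gt0.
  rewrite lnMA //; congr ln.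
  pose side (p : X * X) := if b then p.2 else p.1.
  (* Edge weights are divided by [g]. Summing out the other end leaves the sum of [S / g], which is
     again that of [mu * g], so vertex and edge gain the same factor [A]. *)
  have -> : A = \sum_p muE CE eta lam e p.1 p.2 / g (side p).
    transitivity (\sum_x S x / g x).
      by apply: eq_bigr => x _; rewrite -mug2; field; rewrite gt_eqF.
    rewrite /S /Smarg /side; case: (b).
      rewrite (sum_pairE (fun x y => muE CE eta lam e x y / g y)) exchange_big.
      by apply: eq_bigr => x _; rewrite mulr_suml.
    rewrite (sum_pairE (fun x y => muE CE eta lam e x y / g x)).
    by apply: eq_bigr => x _; rewrite mulr_suml.
  rewrite mulr_sumr; apply: eq_bigr => p _.
  have -> : edge_logits lam' e p =
      edge_logits lam e p - ln (S (side p) / mu (side p)) / 2.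
    rewrite /edge_logits /side; case: (b) lam'E lam'N => lam'E lam'N.
      by rewrite lam'E lam'N //; [field | rewrite xpair_eqE andbF].
    by rewrite lam'E lam'N //; [field | rewrite xpair_eqE andbF].
  by rewrite expRB -/(g _) /muE /wE mulrA mulrCA mulfV ?mulr1 // gt_eqF.
rewrite /dual_obj; under eq_bigr do rewrite vertex.
under [X in _ + X]eq_bigr do rewrite edge.
rewrite !big_split /= -!big_mkcond !big_pred1_eq.
have sum1 : \sum_x mu x * g x ^+ 2 = 1.
  by under eq_bigr do rewrite mug2; exact: SP.2.
have := ln_affinity_le muP g0 mu0 sum1; rewrite -/A.
have -> : \sum_x `|mu x * g x ^+ 2 - mu x| =
    \sum_x `|slack ends CV CE eta lam e b x|.
  by apply: eq_bigr => x _; rewrite mug2.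
lra.
Qed.

End DualFunction.

(** * Accelerated coordinate descent *)

Section Theta.
Context {R : realType}.

(** [theta_step t] is the positive root [s] of [s^2 + t^2 s - t^2 = 0]. *)
Lemma theta_step_spec (t : R) : 0 < t ->
  0 < theta_step t /\ theta_step t ^+ 2 = t ^+ 2 * (1 - theta_step t).
Proof.
move=> t0; rewrite /theta_step; set q := Num.sqrt _.
have D0 : 0 <= t ^+ 4 + 4 * t ^+ 2 by rewrite addr_ge0 ?mulr_ge0 ?exprn_ge0 ?ltW.
have q2 : q ^+ 2 = t ^+ 4 + 4 * t ^+ 2 by rewrite sqr_sqrtr.
have tq : t ^+ 2 < q.
  rewrite -(@ltr_pXn2r _ 2) ?nnegrE ?sqr_ge0 ?sqrtr_ge0 // q2 -exprM.
  by rewrite ltrDl mulr_gt0 ?exprn_gt0.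
split; first by rewrite divr_gt0 // addrC subr_gt0.
have -> : ((- t ^+ 2 + q) / 2) ^+ 2 = (t ^+ 4 - 2 * t ^+ 2 * q + q ^+ 2) / 4 by field.
by rewrite q2; field.
Qed.

Lemma theta_prev_gt0 k : 0 < theta_prev k :> R.
Proof. by elim: k => [|k /theta_step_spec[]]. Qed.

Lemma theta_sqr k : theta k ^+ 2 = theta_prev k ^+ 2 * (1 - theta k) :> R.
Proof. exact: (theta_step_spec (theta_prev_gt0 k)).2. Qed.

Lemma theta_lt1 k : theta k < 1 :> R.
Proof.
have h := theta_sqr k; have t0 := theta_prev_gt0 k; have s0 := theta_prev_gt0 k.+1.
rewrite -subr_gt0 -(@pmulr_rgt0 _ (theta_prev k ^+ 2)) ?exprn_gt0 // -h.
exact: exprn_gt0.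
Qed.

Lemma theta_prev_le k : theta_prev k * (k.+2)%:R <= 2 :> R.
Proof.
elim: k => [|k IH]; first by rewrite mul1r.
have h : theta_prev k.+1 ^+ 2 = theta_prev k ^+ 2 * (1 - theta_prev k.+1) :> R.
  exact: theta_sqr.
have t0 : 0 < theta_prev k :> R by exact: theta_prev_gt0.
have s0 : 0 < theta_prev k.+1 :> R by exact: theta_prev_gt0.
set t := theta_prev k in h t0 IH; set s := theta_prev k.+1 in h s0 *.
(* Equivalently [1/s >= 1/t + 1/2], which makes the reciprocals grow linearly. Were it false,
   squaring [t (2 - s) < 2 s] and using the recurrence would give [(s t)^2 < 0]. *)
have step : 2 * s + s * t <= 2 * t.
  have s1 : s < 1 by exact: (theta_lt1 k).
  rewrite leNgt; apply/negP => lt.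
  have a0 : 0 <= 2 * t - s * t.
    by rewrite -mulrBl mulr_ge0 ?(ltW t0) // subr_ge0 (le_trans (ltW s1)) ?ler1n.
  have ab : 2 * t - s * t < 2 * s by lra.
  have : (2 * t - s * t) ^+ 2 < (2 * s) ^+ 2.
    by rewrite ltr_pXn2r // nnegrE // (le_trans a0 (ltW ab)).
  have -> : (2 * s) ^+ 2 = 4 * (t ^+ 2 * (1 - s)) by rewrite -h; ring.
  have : 0 <= (s * t) ^+ 2 by exact: sqr_ge0.
  nra.
rewrite -[k.+3%:R]natr1; set q : R := k.+2%:R in IH *.
have q0 : 0 <= q by exact: ler0n.
rewrite -(ler_pM2l t0).
nra.
Qed.

End Theta.

(** * Lyapunov analysis against an arbitrary comparator [z] *)

Section Convergence.
Context {R : realType} {V E X : finType}.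
Variables (ends : E -> V * V) (CV : V -> X -> R) (CE : E -> X -> X -> R) (eta : R).
Hypothesis X_gt0 : (0 < #|X|)%N.
Hypothesis E_gt0 : (0 < #|E|)%N.
Hypothesis eta_gt0 : 0 < eta.
Variable z : @dual R E X.

Let obj := dual_obj ends CV CE eta.
Let step := emp_step ends CV CE eta.
Let run := emp_run ends CV CE eta.
Let m : R := #|E|%:R.

Definition sqdist (w : @dual R E X) : R :=
  \sum_(eb : E * bool) \sum_x (w eb.1 eb.2 x - z eb.1 eb.2 x) ^+ 2.

(** The weight on the gap telescopes because [(1 - theta_k) / theta_k^2 = 1 / theta_{k-1}^2]. The
    weight on the distance is matched to the step size [1 / (4 m eta theta_k)] of the second
    sequence. *)
Definition lyapunov (k : nat) (st : @dual R E X * @dual R E X) : R :=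
  (obj st.1 - obj z) / theta_prev k ^+ 2 + 4 * m ^+ 2 * eta ^+ 2 * sqdist st.2.

Lemma sum_sqr_le (T : finType) (f : T -> R) :
  \sum_x f x ^+ 2 <= (\sum_x `|f x|) ^+ 2.
Proof.
rewrite expr2 mulr_suml; apply: ler_sum => x _.
rewrite -(real_normK (num_real (f x))) expr2 ler_wpM2l //.
by rewrite (bigD1 x) //= lerDl sumr_ge0.
Qed.

Lemma card_blocks : #|{: E * bool}|%:R = 2 * m :> R.
Proof. by rewrite card_prod card_bool natrM mulrC. Qed.

(** Conditional expectation times the number [2 * m] of blocks. The quadratic term of the move of
    [w] cancels the descent gain [G / 4] exactly; the linear term is paid for by convexity at
    [y]. *)
Lemma lyapunov_step k st :
  \sum_blk lyapunov k.+1 (step k blk st) <= 2 * m * lyapunov k st.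
Proof.
case: st => lam w; set th : R := theta k; set tp : R := theta_prev k.
have th0 : 0 < th by exact: theta_prev_gt0.
have tp0 : 0 < tp by exact: theta_prev_gt0.
have thE : th ^+ 2 = tp ^+ 2 * (1 - th) by exact: theta_sqr.
have th1 : th < 1 by exact: theta_lt1.
have m0 : 0 < m by rewrite ltr0n.
pose y : @dual R E X := fun e b x => th * w e b x + (1 - th) * lam e b x.
pose nu := slack ends CV CE eta y.
pose G := inner nu nu.
pose wz : @dual R E X := fun e b x => w e b x - z e b x.
have descent : \sum_blk obj (step k blk (lam, w)).1 <= 2 * m * obj y - G / 4.
  rewrite -card_blocks mulr_natl -sumr_const /G mulr_suml -sumrB.
  apply: ler_sum => -[e b] _.
  have := dual_obj_block_step ends CV CE X_gt0 y e b (lt0r_neq0 eta_gt0).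
  move=> /le_trans; apply; rewrite lerD2l lerN2 ler_wpM2r ?invr_ge0 //.
  exact: sum_sqr_le.
have dist : \sum_blk sqdist (step k blk (lam, w)).2 =
    2 * m * sqdist w + 2 * (1 / (4 * m * eta * th)) * inner wz nu
    + (1 / (4 * m * eta * th)) ^+ 2 * G.
  set c := 1 / _.
  rewrite -card_blocks mulr_natl -sumr_const /G !mulr_sumr -!big_split /=.
  apply: eq_bigr => -[e b] _.
  rewrite /sqdist (bigD1 (e, b)) //= [in RHS](bigD1 (e, b)) //= eqxx.
  rewrite (eq_bigr (fun eb : E * bool => \sum_x (w eb.1 eb.2 x - z eb.1 eb.2 x) ^+ 2));
    last by move=> [e' b'] /= /negPf ->.
  suff -> : \sum_x (w e b x + c * nu e b x - z e b x) ^+ 2 =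
      \sum_x (w e b x - z e b x) ^+ 2 + 2 * c * (\sum_x wz e b x * nu e b x)
      + c ^+ 2 * (\sum_x nu e b x * nu e b x) by ring.
  rewrite !mulr_sumr -!big_split /=; apply: eq_bigr => x _.
  by rewrite /wz; ring.
have grad_z := dual_obj_grad ends CV CE eta X_gt0 y z.
have grad_lam := dual_obj_grad ends CV CE eta X_gt0 y lam.
(* Since [y = th w + (1 - th) lam], the direction [th (w - z)] is a combination of those from [y] to
   [z] and to [lam], so [main] is the matching combination of the two gradient inequalities. *)
have coupling : th * inner wz nu = - (th * inner (fun e b x => z e b x - y e b x) nu
    + (1 - th) * inner (fun e b x => lam e b x - y e b x) nu).
  rewrite -!innerZl -innerDl -mulN1r -innerZl; apply: eq_bigr => eb _.
  by apply: eq_bigr => x _; rewrite /wz /y; ring.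
rewrite -/nu -/obj in grad_z grad_lam.
have main : obj y - obj z + eta * (th * inner wz nu) <= (1 - th) * (obj lam - obj z).
  by rewrite coupling; nra.
rewrite /lyapunov big_split /= -mulr_suml -mulr_sumr dist sumrB sumr_const.
rewrite -[obj z *+ _]mulr_natl card_blocks -/th -/tp.
have -> : 4 * m ^+ 2 * eta ^+ 2 * (2 * m * sqdist w
      + 2 * (1 / (4 * m * eta * th)) * inner wz nu
      + (1 / (4 * m * eta * th)) ^+ 2 * G) =
    2 * m * (4 * m ^+ 2 * eta ^+ 2 * sqdist w)
    + (2 * m * (eta * (th * inner wz nu)) + G / 4) / th ^+ 2.
  by field; rewrite !gt_eqF.
rewrite [leRHS]mulrDr [leRHS]addrC addrCA lerD2l -mulrDl [leRHS]mulrA.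
have -> : 2 * m * (obj lam - obj z) / tp ^+ 2 =
    2 * m * ((1 - th) * (obj lam - obj z)) / th ^+ 2.
  by rewrite thE; field; rewrite !gt_eqF // subr_gt0.
rewrite ler_pM2r ?invr_gt0 ?exprn_gt0 //.
have := ler_wpM2l (ltW m0) main; lra.
Qed.

Lemma sum_tuple_cons (T : finType) (n : nat) (f : n.+1.-tuple T -> R) :
  \sum_(s : n.+1.-tuple T) f s = \sum_t \sum_(s : n.-tuple T) f [tuple of t :: s].
Proof.
rewrite pair_bigA /=.
rewrite (reindex (fun p : T * n.-tuple T => [tuple of p.1 :: p.2])) //=.
exists (fun s => (thead s, [tuple of behead s])) => [[t s] _|s _] /=.
  by congr pair; apply: val_inj.
by rewrite [RHS]tuple_eta.
Qed.

(** Induction on the first block drawn; sums over tuples stand for expectations, so each step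
    contributes a factor [2 * m]. *)
Lemma lyapunov_run n k st :
  \sum_(s : n.-tuple (E * bool)) lyapunov (k + n) (run k s st)
  <= (2 * m) ^+ n * lyapunov k st.
Proof.
elim: n k st => [|n IH] k st.
  rewrite expr0 mul1r addn0 (big_pred1 [tuple]) // => s.
  by rewrite [s]tuple0; apply/esym/eqP.
rewrite sum_tuple_cons.
apply: (@le_trans _ _ (\sum_blk (2 * m) ^+ n * lyapunov k.+1 (step k blk st))).
  by apply: ler_sum => blk _; rewrite addnS -addSn; exact: IH.
rewrite -mulr_sumr exprSr -mulrA ler_wpM2l ?exprn_ge0 ?mulr_ge0 ?ler0n //.
exact: lyapunov_step.
Qed.

(** The final distance term is dropped. At the start both sequences vanish and theta_{-1} = 1, which
    leaves the initial gap and the squared norm of [z]. *)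
Lemma accel_emp_rate K :
  \sum_(s : K.-tuple (E * bool)) (obj (accel_emp ends CV CE eta s) - obj z)
  <= (2 * m) ^+ K * (theta_prev K ^+ 2
      * (obj (fun _ _ _ => 0) - obj z + 4 * m ^+ 2 * eta ^+ 2 * inner z z)).
Proof.
have t0 : 0 < theta_prev K ^+ 2 :> R by rewrite exprn_gt0 ?theta_prev_gt0.
have h := lyapunov_run K 0 ((fun _ _ _ => 0), (fun _ _ _ => 0)).
rewrite mulrCA -ler_pdivrMl // mulr_sumr.
have -> : obj (fun _ _ _ => 0) - obj z + 4 * m ^+ 2 * eta ^+ 2 * inner z z =
    lyapunov 0 ((fun _ _ _ => 0), (fun _ _ _ => 0)).
  rewrite /lyapunov /= expr1n divr1; congr (_ + _ * _).
  by apply: eq_bigr => eb _; apply: eq_bigr => x _; rewrite sub0r sqrrN.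
apply: le_trans h; apply: ler_sum => s _.
rewrite /lyapunov add0n mulrC lerDl; apply: mulr_ge0.
  by rewrite -mulrA -exprMn mulr_ge0 ?sqr_ge0.
by apply: sumr_ge0 => eb _; apply: sumr_ge0 => x _; exact: sqr_ge0.
Qed.

End Convergence.

(** * From dual gap to primal error *)

Section PrimalBounds.
Context {R : realType} {V E X : finType}.
Variables (ends : E -> V * V) (CV : V -> X -> R) (CE : E -> X -> X -> R).
Implicit Types (lam z : @dual R E X) (muv : V -> X -> R) (mue : E -> X -> X -> R).

Let m : R := #|E|%:R.
Let n : R := #|V|%:R.
Let d : R := #|X|%:R.
Let C : R := Cnorm CV CE.

Lemma Cnorm_ge0 : 0 <= C.
Proof. by rewrite le_max bigmax_ge_id. Qed.

Lemma CV_le v x : `|CV v x| <= C.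
Proof.
rewrite le_max; apply/orP; left.
apply: le_trans (le_bigmax _ _ v).
exact: (le_bigmax _ (fun x => `|CV v x|) x).
Qed.

Lemma CE_le e x y : `|CE e x y| <= C.
Proof.
rewrite le_max; apply/orP; right.
apply: le_trans (le_bigmax _ _ e).
exact: (le_bigmax _ (fun p => `|CE e p.1 p.2|) (x, y)).
Qed.

Lemma pairing_dist muv mue muv' mue' :
  `|pairing CV CE muv mue - pairing CV CE muv' mue'| <=
  C * (\sum_v \sum_x `|muv v x - muv' v x|
       + \sum_e \sum_p `|mue e p.1 p.2 - mue' e p.1 p.2|).
Proof.
rewrite /pairing opprD addrACA -!sumrB mulrDr !mulr_sumr.
apply: le_trans (ler_normD _ _) _; apply: lerD.
  apply: le_trans (ler_norm_sum _ _ _) _; apply: ler_sum => v _.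
  rewrite -sumrB mulr_sumr; apply: le_trans (ler_norm_sum _ _ _) _.
  by apply: ler_sum => x _; rewrite -mulrBr normrM ler_wpM2r ?CV_le.
apply: le_trans (ler_norm_sum _ _ _) _; apply: ler_sum => e _.
rewrite -sumrB mulr_sumr; apply: le_trans (ler_norm_sum _ _ _) _.
by apply: ler_sum => p _; rewrite -mulrBr normrM ler_wpM2r ?CE_le.
Qed.

Lemma pmf_norm (T : finType) (q : T -> R) : pmf q -> \sum_x `|q x| = 1.
Proof. by case=> q0 <-; apply: eq_bigr => x _; rewrite ger0_norm. Qed.

Lemma pairing_abs_le muv mue : pmfs muv mue ->
  `|pairing CV CE muv mue| <= (n + m) * C.
Proof.
move=> [pv pe].
have := pairing_dist muv mue (fun _ _ => 0) (fun _ _ _ => 0).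
have -> : pairing CV CE (fun _ _ => 0) (fun _ _ _ => 0) = 0.
  by rewrite /pairing !big1 ?addr0 // => ? _; rewrite big1 // => ? _; rewrite mulr0.
rewrite subr0 mulrC => /le_trans; apply; rewrite ler_wpM2r ?Cnorm_ge0 //.
have -> : \sum_v \sum_x `|muv v x - 0| = n.
  rewrite (eq_bigr (fun=> 1)) ?sumr_const // => v _.
  by under eq_bigr do rewrite subr0; exact: pmf_norm.
have -> : \sum_e \sum_p `|mue e p.1 p.2 - 0| = m.
  rewrite (eq_bigr (fun=> 1)) ?sumr_const // => e _.
  by under eq_bigr do rewrite subr0; exact: (pmf_norm (pe e)).
by [].
Qed.

Lemma inL2_pmfs muv mue : inL2 ends muv mue -> pmfs muv mue.
Proof.
case=> muv0 mue0 muv1 row col; split=> [v|e]; first by split.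
split=> [p|]; first exact: mue0.
by rewrite (sum_pairE (mue e)) (eq_bigr (muv (ends e).1)).
Qed.

Lemma inL2_marg muv mue : inL2 ends muv mue ->
  forall e b x, marg (mue e) b x = muv (endpt ends e b) x.
Proof. by case=> _ _ _ row col e [] x; [exact: col | exact: row]. Qed.

Lemma round_mx_marg (F : X -> X -> R) (q : bool -> X -> R) :
    pmf (fun p => F p.1 p.2) -> (forall b, pmf (q b)) ->
  [/\ forall x y, 0 <= round_mx F (q false) (q true) x y,
      forall b x, marg (round_mx F (q false) (q true)) b x = q b x
    & \sum_p `|round_mx F (q false) (q true) p.1 p.2 - F p.1 p.2| <=
      2 * (\sum_x `|q false x - marg F false x| + \sum_x `|q true x - marg F true x|)].
Proof.
move=> [F0 F1] pq; rewrite sum_pairE in F1.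
have {}F0 x y : 0 <= F x y by exact: (F0 (x, y)).
case: (round_mx_spec F0 F1 (pq false) (pq true)) => g0 row col dist.
split=> // [[] x|]; [exact: col | exact: row |].
by rewrite (sum_pairE (fun x y => `|round_mx F (q false) (q true) x y - F x y|)).
Qed.

Section Eta.
Variable eta : R.
Hypothesis X_gt0 : (0 < #|X|)%N.

Let muv_pmf lam v : pmf (muV ends CV eta lam v) := (pmfs_mu ends CV CE eta X_gt0 lam).1 v.
Let mue_pmf lam e := (pmfs_mu ends CV CE eta X_gt0 lam).2 e.

Let proj_spec lam e := @round_mx_marg (muE CE eta lam e)
  (fun b => muV ends CV eta lam (endpt ends e b)) (mue_pmf lam e)
  (fun b => muv_pmf lam (endpt ends e b)).

Lemma proj_inL2 lam :
  inL2 ends (projV ends CV eta lam) (projE ends CV CE eta lam).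
Proof.
split=> [v x|e x y|v|e x|e x].
- exact: (muv_pmf lam v).1.
- by case: (proj_spec lam e) => /(_ x y).
- exact: (muv_pmf lam v).2.
- by case: (proj_spec lam e) => _ /(_ false x).
- by case: (proj_spec lam e) => _ /(_ true x).
Qed.

Lemma projE_dist lam e :
  \sum_p `|projE ends CV CE eta lam e p.1 p.2 - muE CE eta lam e p.1 p.2| <=
  2 * (\sum_x `|slack ends CV CE eta lam e false x|
       + \sum_x `|slack ends CV CE eta lam e true x|).
Proof.
case: (proj_spec lam e) => _ _ /le_trans; apply.
by rewrite ler_pM2l // lerD //; apply: ler_sum => x _; rewrite distrC.
Qed.

Hypothesis eta_gt0 : 0 < eta.

Let d_ge1 : 1 <= d. Proof. by rewrite ler1n. Qed.

(* Mixing a feasible point with the uniform one at rate [d s] makes room for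
   slacks of size [s]: the result is feasible for the polytope whose slacks are
   those of [lam], on which mu^lam minimises the entropic objective. *)
Lemma slack_comparator lam (s : R) muv mue : 0 <= s -> d * s <= 1 ->
    (forall e b, \sum_x `|slack ends CV CE eta lam e b x| <= s) ->
    inL2 ends muv mue ->
  exists pv pe, [/\ pmfs pv pe,
    forall e b x, residual ends pv pe e b x = slack ends CV CE eta lam e b x,
    forall v, \sum_x `|pv v x - muv v x| <= 2 * (d * s) &
    forall e, \sum_p `|pe e p.1 p.2 - mue e p.1 p.2| <= 12 * (d * s)].
Proof.
move=> s0 ds1 slack_le mu2; have [mvP meP] := inL2_pmfs mu2.
pose nu := slack ends CV CE eta lam.
pose pv v x := (1 - d * s) * muv v x + s.
(* The edge marginals to aim for: nonnegative since [pv >= s >= |nu|], of mass 1 since slacks sum to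
   zero. Rounding [mue] to them produces the edge part. *)
pose q e b x := pv (endpt ends e b) x + nu e b x.
have pv_ge v x : s <= pv v x.
  by rewrite lerDr mulr_ge0 ?subr_ge0 // (mvP v).1.
have pvP v : pmf (pv v).
  split=> [x|]; first exact: le_trans (pv_ge v x).
  rewrite big_split /= -mulr_sumr (mvP v).2 sumr_const -[s *+ _]mulr_natl -/d; ring.
have nu_le e b x : `|nu e b x| <= s.
  apply: le_trans (slack_le e b); rewrite (bigD1 x) //= lerDl.
  by apply: sumr_ge0.
have qP e b : pmf (q e b).
  split=> [x|]; last by rewrite big_split /= (pvP _).2 slack_sum0 // addr0.
  have := nu_le e b x; have := pv_ge (endpt ends e b) x.
  rewrite ler_norml /q => h1 /andP[h2 _]; lra.
have pv_dist v : \sum_x `|pv v x - muv v x| <= 2 * (d * s).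
  apply: (@le_trans _ _ (\sum_x (s + d * s * muv v x))).
    apply: ler_sum => x _.
    have -> : pv v x - muv v x = s - d * s * muv v x by rewrite /pv; ring.
    apply: le_trans (ler_normB _ _) _.
    by rewrite !ger0_norm // !mulr_ge0 ?(mvP v).1 // ler0n.
  rewrite big_split /= -mulr_sumr (mvP v).2 sumr_const -[s *+ _]mulr_natl -/d; lra.
have rnd e := round_mx_marg (meP e) (qP e).
exists pv, (fun e => round_mx (mue e) (q e false) (q e true)); split=> //.
- split=> // e; case: (rnd e) => g0 row _; split=> [p|]; first exact: g0.
  rewrite sum_pairE (eq_bigr (q e false)) ?(qP e false).2 // => x _.
  exact: (row false x).
- by move=> e b x; case: (rnd e) => _ mg _; rewrite /residual mg /q addrC addKr.
move=> e; case: (rnd e) => _ _ /le_trans; apply.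
(* Moving the vertex marginal costs 2 and the slack 1, using [s <= d * s]. Two sides and the factor
   2 of the rounding then give 12. *)
have qdist b : \sum_x `|q e b x - marg (mue e) b x| <= 3 * (d * s).
  apply: (@le_trans _ _ (\sum_x (`|pv (endpt ends e b) x - muv (endpt ends e b) x|
      + `|nu e b x|))).
    apply: ler_sum => x _; rewrite (inL2_marg mu2) /q addrAC.
    exact: ler_normD.
  rewrite big_split /=; have := pv_dist (endpt ends e b); have := slack_le e b.
  rewrite -/nu; have : s <= d * s by rewrite ler_peMl.
  lra.
have := qdist false; have := qdist true; lra.
Qed.

(** The comparator has the slacks of mu^lam, so the multiplier terms cancel and only entropy
    separates the two costs. On edges, 16 is 12 for the comparator plus 4 for the rounding. *)
Lemma primal_gap lam (s : R) muv mue : 0 <= s ->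
    (forall e b, \sum_x `|slack ends CV CE eta lam e b x| <= s) ->
    inL2 ends muv mue ->
  pairing CV CE (projV ends CV eta lam) (projE ends CV CE eta lam) <=
  pairing CV CE muv mue + (n + 2 * m) * ln d / eta + 16 * ((n + m) * C) * d * s.
Proof.
move=> s0 slack_le mu2.
have Q0 : 0 <= (n + m) * C by rewrite mulr_ge0 ?Cnorm_ge0 ?addr_ge0 ?ler0n.
have H0 : 0 <= (n + 2 * m) * ln d / eta.
  by rewrite divr_ge0 ?(ltW eta_gt0) // mulr_ge0 ?ln_ge0 // addr_ge0 ?mulr_ge0 ?ler0n.
(* Without room to mix, the claim is trivial: two feasible costs differ by at most
   [2 * ((n + m) * C)]. *)
have [ds1|ds1] := leP (d * s) 1; last first.
  have := pairing_abs_le (inL2_pmfs mu2).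
  have := pairing_abs_le (inL2_pmfs (proj_inL2 lam)).
  rewrite !ler_norml => /andP[_ h1] /andP[h2 _].
  have : (n + m) * C <= (n + m) * C * (d * s) by rewrite ler_peMr // ltW.
  nra.
have [pv [pe [pP pres pvd ped]]] := slack_comparator s0 ds1 slack_le mu2.
have Hlam := total_entropy_le X_gt0 (pmfs_mu ends CV CE eta X_gt0 lam).
have Hp := total_entropy_ge0 pP.
have := dual_obj_ge ends CV CE eta lam pP.
have -> : inner lam (residual ends pv pe) = inner lam (slack ends CV CE eta lam).
  by apply: eq_bigr => eb _; apply: eq_bigr => x _; rewrite pres.
rewrite (dual_obj_eq ends CV CE eta X_gt0 lam).
set Pmu := pairing _ _ (muV _ _ _ _) _; set Pp := pairing _ _ pv pe => vari.
have gibbs : Pmu <= Pp + (n + 2 * m) * ln d / eta.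
  rewrite -(ler_pM2l eta_gt0) [leRHS]mulrDr [eta * (_ / _)]mulrC divfK ?gt_eqF //.
  rewrite -/n -/m -/d in Hlam; lra.
have dist1 : `|pairing CV CE (projV ends CV eta lam) (projE ends CV CE eta lam) - Pmu|
    <= C * (4 * (m * s)).
  apply: le_trans (pairing_dist _ _ _ _) _; rewrite ler_wpM2l ?Cnorm_ge0 //.
  rewrite big1 ?add0r => [|v _]; last by rewrite big1 // => x _; rewrite subrr normr0.
  apply: (@le_trans _ _ (\sum_(e : E) 4 * s)).
    apply: ler_sum => e _; apply: le_trans (projE_dist lam e) _.
    have := slack_le e false; have := slack_le e true; lra.
  by rewrite sumr_const -[leLHS]mulr_natl -/m mulrCA.
have dist2 : `|Pp - pairing CV CE muv mue| <= C * ((2 * n + 12 * m) * (d * s)).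
  apply: le_trans (pairing_dist _ _ _ _) _; rewrite ler_wpM2l ?Cnorm_ge0 //.
  rewrite mulrDl; apply: lerD.
    apply: (@le_trans _ _ (\sum_(v : V) 2 * (d * s))); first exact: ler_sum.
    by rewrite sumr_const -[leLHS]mulr_natl -/n mulrCA mulrA.
  apply: (@le_trans _ _ (\sum_(e : E) 12 * (d * s))); first exact: ler_sum.
  by rewrite sumr_const -[leLHS]mulr_natl -/m mulrCA mulrA.
move: dist1 dist2; rewrite !ler_norml => /andP[_ h1] /andP[_ h2].
have sds : C * (4 * (m * s)) <= C * (4 * (m * (d * s))).
  by rewrite ler_wpM2l ?Cnorm_ge0 // ler_pM2l // ler_wpM2l ?ler0n // ler_peMl.
have : 0 <= n * C * (d * s) by rewrite !mulr_ge0 ?Cnorm_ge0 ?ler0n.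
lra.
Qed.

(** A bound on the oscillation of the cost over all distributions, plus the entropy bound divided by
    [eta]. *)
Definition dual_radius : R := 2 * ((n + m) * C) + (n + 2 * m) * ln d / eta.

(* Slater: test the dual objective at [z] against the point whose vertex
   marginals are uniform and whose edge marginals sit at the minima of [z]. *)
Lemma dual_radius_spec z :
    (forall e b, \sum_x z e b x = 0) ->
    dual_obj ends CV CE eta z <= dual_obj ends CV CE eta (fun _ _ _ => 0) ->
  inner z z <= (d * dual_radius) ^+ 2 /\
  dual_obj ends CV CE eta (fun _ _ _ => 0) - dual_obj ends CV CE eta z
    <= eta * dual_radius.
Proof.
move=> z_mean z_le; have [x0 _] := card_gt0P X_gt0.
pose t e b : X := [arg min_(x < x0) z e b x]%O.
have tP e b x : z e b (t e b) <= z e b x.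
  by rewrite /t; case: arg_minP => // i _; apply.
pose M e b := - z e b (t e b).
have M0 e b : 0 <= M e b.
  rewrite oppr_ge0 -(pmulr_rle0 _ (lt_le_trans ltr01 d_ge1)) -(z_mean e b).
  by rewrite mulr_natl -sumr_const; apply: ler_sum.
pose pv (v : V) (x : X) : R := d^-1.
pose pe e x y : R := (x == t e false)%:R * (y == t e true)%:R.
have pmP e b x : marg (pe e) b x = (x == t e b)%:R.
  case: b => /=; rewrite /pe; first by rewrite -mulr_suml (pmf_point (t e false)).2 mul1r.
  by rewrite -mulr_sumr (pmf_point (t e true)).2 mulr1.
have pP : pmfs pv pe.
  split=> [v|e]; first exact: pmf_uniform.
  split=> [p|]; first by rewrite mulr_ge0 ?ler0n.
  rewrite sum_pairE (eq_bigr (fun x => (x == t e false)%:R)) ?(pmf_point _).2 // => x _.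
  exact: (pmP e false x).
(* Uniform vertex marginals annihilate a centred [z]; only the block minima remain. *)
have zres : inner z (residual ends pv pe) = - \sum_(eb : E * bool) M eb.1 eb.2.
  rewrite -sumrN; apply: eq_bigr => -[e b] _ /=.
  under eq_bigr do rewrite /residual pmP mulrBr.
  rewrite sumrB -mulr_suml z_mean mul0r subr0 opprK (bigD1 (t e b)) //= eqxx mulr1.
  by rewrite big1 ?addr0 // => x /negPf ->; rewrite mulr0.
have lower := dual_obj_ge ends CV CE eta z pP.
rewrite zres in lower.
have Hp := total_entropy_ge0 pP.
have upper := dual_obj_eq ends CV CE eta X_gt0 (fun _ _ _ => 0).
have in0 nu : inner (fun _ _ _ => 0) nu = 0 :> R.
  by apply: big1 => eb _; apply: big1 => x _; rewrite mul0r.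
rewrite in0 addr0 in upper.
have H0 := total_entropy_le X_gt0 (pmfs_mu ends CV CE eta X_gt0 (fun _ _ _ => 0)).
have := pairing_abs_le (pmfs_mu ends CV CE eta X_gt0 (fun _ _ _ => 0)).
have := pairing_abs_le pP.
rewrite !ler_norml -/n -/m -/d => /andP[p1 p2] /andP[p3 p4].
set SM := \sum_(eb : E * bool) _ in lower *.
have SM0 : 0 <= SM by apply: sumr_ge0.
have radE : eta * dual_radius = 2 * (eta * ((n + m) * C)) + (n + 2 * m) * ln d.
  by rewrite /dual_radius; field; rewrite gt_eqF.
rewrite -/n -/m -/d in H0.
have q1 := ler_wpM2l (ltW eta_gt0) p2.
have q2 := ler_wpM2l (ltW eta_gt0) p3.
have SMle : SM <= dual_radius.
  rewrite -(ler_pM2l eta_gt0) radE; lra.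
split; last first.
  rewrite radE; have : 0 <= eta * SM by rewrite mulr_ge0 // ltW.
  lra.
apply: (@le_trans _ _ (d ^+ 2 * SM ^+ 2)); last first.
  by rewrite exprMn ler_wpM2l ?sqr_ge0 // ler_pXn2r ?nnegrE // (le_trans SM0).
apply: (@le_trans _ _ (\sum_(eb : E * bool) d ^+ 2 * M eb.1 eb.2 ^+ 2)); last first.
  rewrite -mulr_sumr ler_wpM2l ?sqr_ge0 //.
  have -> : SM = \sum_(eb : E * bool) `|M eb.1 eb.2|.
    by apply: eq_bigr => eb _; rewrite ger0_norm.
  exact: sum_sqr_le.
apply: ler_sum => -[e b] _ /=.
(* Raised by its depth [M], the block is nonnegative with sum [d * M]. Centring kills the cross
   term, so the squares of [z] are dominated by those of the raised block. *)
have := sum_sqr_le (fun x => z e b x + M e b).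
have -> : \sum_x `|z e b x + M e b| = d * M e b.
  rewrite (eq_bigr (fun x => z e b x + M e b)) => [|x _].
    by rewrite big_split /= z_mean add0r sumr_const mulr_natl.
  by rewrite ger0_norm // subr_ge0.
rewrite exprMn; apply: le_trans.
have -> : \sum_x (z e b x + M e b) ^+ 2 =
    \sum_x z e b x * z e b x + 2 * M e b * \sum_x z e b x + \sum_(x : X) M e b ^+ 2.
  by rewrite mulr_sumr -!big_split; apply: eq_bigr => x _ /=; ring.
by rewrite z_mean mulr0 addr0 lerDl sumr_ge0 // => x _; exact: sqr_ge0.
Qed.

End Eta.
End PrimalBounds.

(** * Accuracy of Accel-EMP *)

Lemma ln_ge_half {R : realType} (k : nat) : (2 <= k)%N -> 1 / 2 <= ln k%:R :> R.
Proof.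
move=> k2; apply: (@le_trans _ _ (ln 2)); last first.
  by rewrite ler_ln ?posrE ?ltr0n ?ler_nat // (leq_trans _ k2).
have := @le_ln1Dx R (- (1 / 2)).
have -> : 1 + - (1 / 2) = 2^-1 :> R by field.
rewrite lnV ?posrE // => h.
have : ln 2 *- 1 <= - (1 / 2) :> R by apply: h; lra.
lra.
Qed.

Section Accuracy.
Context {R : realType} {V E X : finType}.
Variables (ends : E -> V * V) (CV : V -> X -> R) (CE : E -> X -> X -> R) (eta : R).
Hypothesis X_gt0 : (0 < #|X|)%N.
Hypothesis E_gt0 : (0 < #|E|)%N.
Hypothesis eta_gt0 : 0 < eta.

Let m : R := #|E|%:R.
Let n : R := #|V|%:R.
Let d : R := #|X|%:R.
Let B : R := dual_radius CV CE eta.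
Let obj := dual_obj ends CV CE eta.
Let out K (s : K.-tuple (E * bool)) := accel_emp ends CV CE eta s.

(* A point that is at least as good as every block step from every possible
   output can play the role of the minimiser, which need not be constructed. *)
Lemma dual_comparator K : exists z : @dual R E X,
  [/\ forall (s : K.-tuple (E * bool)) e b,
        obj z <= obj (block_step ends CV CE eta (out s) e b),
      inner z z <= (d * B) ^+ 2 & obj (fun _ _ _ => 0) - obj z <= eta * B].
Proof.
pose cand (i : option (K.-tuple (E * bool) * (E * bool))) : @dual R E X :=
  if i is Some (s, (e, b)) then block_step ends CV CE eta (out s) e b
  else fun _ _ _ => 0.
pose i0 := [arg min_(i < None) obj (cand i)]%O.
have i0P i : obj (cand i0) <= obj (cand i).
  by rewrite /i0; case: arg_minP => // j _; apply.
pose mean e b := (\sum_x cand i0 e b x) / d.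
pose z : @dual R E X := fun e b x => cand i0 e b x - mean e b.
have zle i : obj z <= obj (cand i).
  exact: le_trans (dual_obj_shift ends CV CE eta X_gt0 _ mean) (i0P i).
have z_mean e b : \sum_x z e b x = 0.
  rewrite sumrB sumr_const -[mean e b *+ _]mulr_natl -/d /mean mulrC divfK ?subrr //.
  by rewrite pnatr_eq0 -lt0n.
have [zz zgap] := dual_radius_spec X_gt0 eta_gt0 z_mean (zle None).
by exists z; split=> // s e b; exact: (zle (Some (s, (e, b)))).
Qed.

(** A bound affine in the dual gap, valid for each realisation, can be averaged directly;
    [accel_emp_rate] then controls the averaged gap. *)
Lemma average_pairing_le (eps : R) K muv mue : 0 < eps -> inL2 ends muv mue ->
  (#|{: E * bool}|%:R ^+ K)^-1 * \sum_(s : K.-tuple (E * bool))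
      pairing CV CE (projV ends CV eta (out s)) (projE ends CV CE eta (out s))
  <= pairing CV CE muv mue + (n + 2 * m) * ln d / eta + eps / 4
     + 4 ^+ 5 * ((n + m) * Cnorm CV CE) ^+ 2 * d ^+ 2 / eps
       * (theta_prev K ^+ 2 * (eta * B + 4 * m ^+ 2 * eta ^+ 2 * (d * B) ^+ 2)).
Proof.
move=> eps0 mu2; have [z [zstep zz zgap]] := dual_comparator K.
set Q := (n + m) * _; set k := 4 ^+ 5 * Q ^+ 2 * d ^+ 2 / eps.
set base := pairing CV CE muv mue + _ + eps / 4.
have k0 : 0 <= k.
  by rewrite divr_ge0 ?(ltW eps0) // mulr_ge0 ?sqr_ge0 // mulr_ge0 ?sqr_ge0 ?exprn_ge0.
have pointwise (s : K.-tuple (E * bool)) :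
    pairing CV CE (projV ends CV eta (out s)) (projE ends CV CE eta (out s))
    <= base + k * (obj (out s) - obj z).
  (* A block step from the output gains a quarter of the squared block slack and cannot fall below
     [obj z], whence the 4. *)
  set u := 4 * (obj (out s) - obj z); set r := Num.sqrt u.
  have slack2 e b : (\sum_x `|slack ends CV CE eta (out s) e b x|) ^+ 2 <= u.
    have := dual_obj_block_step ends CV CE X_gt0 (out s) e b (lt0r_neq0 eta_gt0).
    by have := zstep s e b; rewrite /u /obj; lra.
  have u0 : 0 <= u.
    by have [e _] := card_gt0P E_gt0; apply: le_trans (slack2 e false); exact: sqr_ge0.
  have r0 : 0 <= r by exact: sqrtr_ge0.
  have slackr e b : \sum_x `|slack ends CV CE eta (out s) e b x| <= r.
    by rewrite -(ler_pXn2r (n := 2)) ?nnegrE ?sumr_ge0 // sqr_sqrtr.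
  have := primal_gap X_gt0 eta_gt0 r0 slackr mu2; rewrite -/m -/n -/d -/Q.
  (* AM-GM turns the square root of the dual gap into the gap itself,
     with the factor 4 ^ 5 = 16 ^ 2 * 4. *)
  have amgm : 16 * Q * d * r <= eps / 4 + k * (obj (out s) - obj z).
    have -> : k * (obj (out s) - obj z) = (16 * Q * d * r) ^+ 2 / eps.
      by rewrite 3!exprMn sqr_sqrtr // /u /k; field; rewrite gt_eqF.
    rewrite -subr_ge0.
    have -> : eps / 4 + (16 * Q * d * r) ^+ 2 / eps - 16 * Q * d * r =
        (16 * Q * d * r - eps / 2) ^+ 2 / eps by field; rewrite gt_eqF.
    by rewrite divr_ge0 ?sqr_ge0 // ltW.
  by rewrite /base; lra.
have N0 : 0 < #|{: E * bool}|%:R ^+ K :> R.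
  by rewrite exprn_gt0 // ltr0n card_prod card_bool muln_gt0 E_gt0.
rewrite ler_pdivrMl //.
apply: le_trans (ler_sum _ (fun s _ => pointwise s)) _.
rewrite big_split /= sumr_const card_tuple -mulr_sumr.
rewrite -[base *+ _]mulr_natl natrX [leRHS]mulrDr.
rewrite lerD2l mulrCA ler_wpM2l //.
have := accel_emp_rate ends CV CE X_gt0 E_gt0 eta_gt0 z K.
rewrite -(@card_blocks R E) => /le_trans; apply.
rewrite ler_pM2l // ler_pM2l ?exprn_gt0 ?theta_prev_gt0 // lerD // ler_wpM2l //.
by rewrite -mulrA -exprMn mulr_ge0 ?sqr_ge0 ?exprn_ge0.
Qed.

End Accuracy.

(** * Choice of constants and conclusion *)

Lemma entropy_budget {R : realType} (m n l eps : R) :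
    0 < m -> 0 <= n -> 0 < l -> 0 < eps ->
  (n + 2 * m) * l / (4 * (m + n) * l / eps) <= eps / 2.
Proof.
move=> m0 n0 l0 eps0.
have -> : (n + 2 * m) * l / (4 * (m + n) * l / eps) =
    eps / 4 * ((n + 2 * m) / (m + n)).
  by field; rewrite !gt_eqF //; lra.
have : (n + 2 * m) / (m + n) <= 2 by rewrite ler_pdivrMr; lra.
nra.
Qed.

(** For [eps < 2 * Q] the entropy part of [B] is absorbed, giving [B <= 3 * Q]. After substitution
    of [eta], the left side is bounded by a constant times [(t W)^2 eps / m], with [W] the iteration
    threshold without its constant. *)
Lemma dual_budget {R : realType} (m n d l Q eps t K : R) (eta := 4 * (m + n) * l / eps)
    (B := 2 * Q + (n + 2 * m) * l / eta) :
    1 <= m -> 0 <= n -> 2 <= d -> 1 / 2 <= l -> 0 < eps -> eps < 2 * Q ->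
    0 < t -> t * K <= 2 ->
    16 ^+ 3 * (m * Num.sqrt m) * d ^+ 2 * ((m + n) * Q ^+ 2) / eps ^+ 2 * l <= K ->
  4 ^+ 5 * Q ^+ 2 * d ^+ 2 / eps
    * (t ^+ 2 * (eta * B + 4 * m ^+ 2 * eta ^+ 2 * (d * B) ^+ 2)) <= eps / 4.
Proof.
move=> m_ge1 n_ge0 d_ge2 l_ge eps_gt0 eps_lt t_gt0 tK K_ge.
pose W := m * Num.sqrt m * d ^+ 2 * ((m + n) * Q ^+ 2) / eps ^+ 2 * l.
have tW : 16 ^+ 3 * (t * W) <= 2.
  apply: le_trans tK; rewrite mulrCA ler_pM2l //; apply: le_trans K_ge.
  by rewrite /W !mulrA.
clear K_ge tK.
have m0 : 0 <= m by exact: le_trans m_ge1.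
have W2 : W ^+ 2 = m ^+ 3 * d ^+ 4 * (m + n) ^+ 2 * Q ^+ 4 * l ^+ 2 / eps ^+ 4.
  have h : Num.sqrt m ^+ 2 = m by rewrite sqr_sqrtr.
  have -> : m ^+ 3 = m ^+ 2 * Num.sqrt m ^+ 2 by rewrite h; ring.
  by rewrite /W; field; rewrite gt_eqF.
have etaE : eta = 4 * (m + n) * l / eps by [].
have eta_gt0 : 0 < eta by rewrite etaE divr_gt0 // !mulr_gt0 //; lra.
have BE : B = 2 * Q + (n + 2 * m) * l / eta by [].
have budget : (n + 2 * m) * l / eta <= eps / 2 by apply: entropy_budget; lra.
clearbody B; clearbody eta.
have Q0 : 0 < Q by lra.
have B0 : 2 * Q <= B.
  by rewrite BE lerDl divr_ge0 ?(ltW eta_gt0) // mulr_ge0; lra.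
have B3 : B <= 3 * Q by lra.
have etaB : 1 <= eta * B.
  apply: (@le_trans _ _ (eta * eps)); last by rewrite ler_pM2l //; lra.
  rewrite etaE divfK ?gt_eqF //; nra.
(* As [eta * B] and [m * d] are at least 1, one copy of the square dominates the linear term: 5 = 1
   + 4. *)
have step1 : eta * B + 4 * m ^+ 2 * eta ^+ 2 * (d * B) ^+ 2 <=
    5 * (m * d * (eta * (3 * Q))) ^+ 2.
  have md : 1 <= m * d by nra.
  set a := eta * B in etaB *.
  have aq : a <= eta * (3 * Q) by rewrite ler_pM2l.
  have a2 : a <= (m * d * a) ^+ 2.
    have h : a <= m * d * a by rewrite ler_peMl // (le_trans _ etaB).
    by rewrite expr2 (le_trans h) // ler_peMr ?(le_trans _ h) ?(le_trans etaB) //; lra.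
  have -> : 4 * m ^+ 2 * eta ^+ 2 * (d * B) ^+ 2 = 4 * (m * d * a) ^+ 2.
    by rewrite /a; ring.
  have : (m * d * a) ^+ 2 <= (m * d * (eta * (3 * Q))) ^+ 2.
    have md0 : 0 < m * d by lra.
    have a0 : 0 <= m * d * a by rewrite mulr_ge0; lra.
    have mda : m * d * a <= m * d * (eta * (3 * Q)) by rewrite ler_pM2l.
    by rewrite ler_pXn2r ?nnegrE // (le_trans a0).
  lra.
have W0 : 0 <= W.
  have mnQ : 0 <= (m + n) * Q ^+ 2 by rewrite mulr_ge0 ?sqr_ge0 //; lra.
  apply: mulr_ge0; last lra.
  apply: divr_ge0; last exact: sqr_ge0.
  apply: mulr_ge0 => //; apply: mulr_ge0; last exact: sqr_ge0.
  by rewrite mulr_ge0 ?sqrtr_ge0.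
have tW2 : (16 ^+ 3 * (t * W)) ^+ 2 <= 4.
  have -> : 4 = 2 ^+ 2 :> R by rewrite -natrX.
  have tW0 : 0 <= 16 ^+ 3 * (t * W) by rewrite pmulr_rge0 ?exprn_gt0 // pmulr_rge0.
  by rewrite ler_pXn2r ?nnegrE.
have k0 : 0 <= 4 ^+ 5 * Q ^+ 2 * d ^+ 2 / eps.
  by rewrite divr_ge0 ?(ltW eps_gt0) // -mulrA -exprMn mulr_ge0 ?sqr_ge0 ?exprn_ge0.
apply: (@le_trans _ _ (4 ^+ 5 * Q ^+ 2 * d ^+ 2 / eps
   * (t ^+ 2 * (5 * (m * d * (eta * (3 * Q))) ^+ 2)))).
  by rewrite ler_wpM2l // ler_wpM2l ?sqr_ge0.
(* Here 45 = 5 * 3^2; with [tW2] and [em] the total is at most 180/1024 of [eps], below a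
   quarter. *)
have -> : 4 ^+ 5 * Q ^+ 2 * d ^+ 2 / eps * (t ^+ 2 * (5 * (m * d * (eta * (3 * Q))) ^+ 2))
    = 45 / 4 ^+ 5 * (16 ^+ 3 * (t * W)) ^+ 2 * (eps / m).
  rewrite [(16 ^+ 3 * (t * W)) ^+ 2]exprMn [(t * W) ^+ 2]exprMn W2 etaE.
  by field; rewrite !gt_eqF //; lra.
have em : eps / m <= eps by rewrite ler_pdivrMr ?ler_peMr ?(ltW eps_gt0) //; lra.
have em0 : 0 <= eps / m by rewrite divr_ge0 // ltW.
have := ler_pM (sqr_ge0 (16 ^+ 3 * (t * W))) em0 tW2 em; lra.
Qed.

Theorem theorem2 (R : realType) :
  exists c : R, 0 < c /\
  forall (V E X : finType) (ends : E -> V * V),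
    simple_graph ends -> no_isolated ends -> (2 <= #|X|)%N ->
  forall (CV : V -> X -> R) (CE : E -> X -> X -> R) (eps : R), 0 < eps ->
  let m : R := #|E|%:R in
  let n : R := #|V|%:R in
  let d : R := #|X|%:R in
  let eta : R := 4 * (m + n) * ln d / eps in
  forall K : nat,
    c * (m * Num.sqrt m) * d ^+ 2 * (m + n) ^+ 3 * Cnorm CV CE ^+ 2
      / eps ^+ 2 * ln d <= K%:R ->
  (* hat mu in L_2 for every realisation of the random block choices *)
  (forall s : K.-tuple (E * bool),
     inL2 ends (projV ends CV eta (accel_emp ends CV CE eta s))
               (projE ends CV CE eta (accel_emp ends CV CE eta s))) /\
  (* expectation over K i.i.d. uniform blocks, compared with every point of
     L_2 (hence with the minimum over L_2) *)
  (forall (muv : V -> X -> R) (mue : E -> X -> X -> R),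
     inL2 ends muv mue ->
     (#|{: E * bool}|%:R ^+ K)^-1 *
       \sum_(s : K.-tuple (E * bool))
          pairing CV CE (projV ends CV eta (accel_emp ends CV CE eta s))
                        (projE ends CV CE eta (accel_emp ends CV CE eta s))
     <= pairing CV CE muv mue + eps).
Proof.
exists (16 ^+ 3); split=> [|V E X ends _ no_iso d2 CV CE eps eps0 m n d eta K K_ge].
  exact: exprn_gt0.
have X0 : (0 < #|X|)%N by exact: ltnW.
split=> [s|muv mue mu2]; first exact: proj_inL2.
set Q := (n + m) * Cnorm CV CE.
have QC muv' mue' : inL2 ends muv' mue' -> `|pairing CV CE muv' mue'| <= Q.
  by move=> /inL2_pmfs; exact: pairing_abs_le.
(* Without edges there are no vertices either, and every cost is 0. *)
have [E0|E0] := eqVneq #|E| 0%N.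
  have V0 : #|V| = 0%N.
    by apply: eq_card0 => v; have [e] := no_iso v; have := card0_eq E0 e.
  have Q0 : Q = 0 by rewrite /Q /n /m V0 E0 addr0 mul0r.
  have pair0 muv' mue' : inL2 ends muv' mue' -> pairing CV CE muv' mue' = 0.
    by move=> /QC; rewrite Q0 normr_le0 => /eqP.
  rewrite big1 => [|s _]; last by apply: pair0; exact: proj_inL2.
  by rewrite mulr0 pair0 // add0r ltW.
rewrite -lt0n in E0.
have m1 : 1 <= m by rewrite ler1n.
have n0 : 0 <= n by exact: ler0n.
have d_ge2 : 2 <= d by rewrite ler_nat.
have l_ge : 1 / 2 <= ln d by exact: ln_ge_half.
(* If [2 * Q <= eps], every feasible point is already [eps]-optimal; the other case supplies the
   hypothesis of [dual_budget]. *)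
have [Qsmall|Qlarge] := leP (2 * Q) eps.
  have NK : #|{: K.-tuple (E * bool)}|%:R = #|{: E * bool}|%:R ^+ K :> R.
    by rewrite card_tuple natrX.
  rewrite -NK.
  have N0 : (0 : R) < #|{: K.-tuple (E * bool)}|%:R.
    by rewrite NK exprn_gt0 // ltr0n card_prod card_bool muln_gt0 E0.
  rewrite ler_pdivrMl // mulr_natl -sumr_const; apply: ler_sum => s _.
  have := QC _ _ mu2.
  have := QC _ _ (proj_inL2 ends CV CE eta X0 (accel_emp ends CV CE eta s)).
  by rewrite !ler_norml => /andP[_ h1] /andP[h2 _]; lra.
have eta0 : 0 < eta by rewrite /eta divr_gt0 // !mulr_gt0 //; lra.
(* The error splits as [eps / 2] for entropy, [eps / 4] from AM-GM and [eps / 4] for the dual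
   gap. *)
apply: le_trans (average_pairing_le CV CE X0 E0 eta0 K eps0 mu2) _.
rewrite -/m -/n -/d -/Q.
have ent : (n + 2 * m) * ln d / eta <= eps / 2 by apply: entropy_budget; lra.
have tK : theta_prev K * K%:R <= 2 :> R.
  apply: le_trans (theta_prev_le K); rewrite ler_pM2l ?theta_prev_gt0 // ler_nat.
  exact: leq_trans (leqnSn _) (leqnSn _).
have KQ : 16 ^+ 3 * (m * Num.sqrt m) * d ^+ 2 * ((m + n) * Q ^+ 2) / eps ^+ 2 * ln d
    <= K%:R.
  apply: le_trans K_ge; rewrite le_eqVlt; apply/orP; left; apply/eqP.
  by rewrite /Q; field; rewrite gt_eqF.
have := dual_budget m1 n0 d_ge2 l_ge eps0 Qlarge (theta_prev_gt0 K) tK KQ.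
rewrite -/eta /dual_radius -/m -/n -/d -/Q; lra.
Qed.
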